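(* For every $n \ge 1$, every function $f$ with domain $\{0,1\}^n$ (and arbitrary codomain) and every $p \in [0,1]$, \[ \mathbb{E}[\ \mathsf{DT}(f{\upharpoonright}\mathbf R_p)\ ] \le \mathsf{DT}(f)^{\log_2(1+p)}. \] Moreover, this bound holds with equality when $f$ is a parity function $f(x_1,\dots,x_k) = x_1 \oplus \dots \oplus x_k$.
   Context: For $p\in[0,1]$, the $p$-random restriction $\mathbf R_p$ on variables $x_1,\dots,x_n$ independently leaves each variable free (assigns it $\ast$) with probability $p$, and otherwise sets it to $0$ or to $1$, each with probability $(1-p)/2$. For a restriction $\rho:[n]\to\{0,1,\ast\}$, let $\mathrm{Stars}(\rho)=\rho^{-1}(\ast)$; for $f$ with domain $\{0,1\}^n$, $f{\upharpoonright}\rho$ is the function on $\{0,1\}^{\mathrm{Stars}(\rho)}$ obtained by fixing each variable $x_i$ with $i\notin \mathrm{Stars}(\rho)$ to $\rho(i)$. A decision tree is a rooted binary tree whose internal nodes are labeled by variables $x_i$ (with the two outgoing edges labeled $x_i=0$ and $x_i=1$) and whose leaves are labeled by output values (arbitrary, not necessarily Boolean); its size is its number of leaves. $\mathsf{DT}(f)$ is the minimum size of a decision tree computing $f$. *)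

(* Defs.v *)
From mathcomp Require Import all_boot all_order all_algebra.
From mathcomp Require Import boolp reals exp.

Set Implicit Arguments.
Unset Strict Implicit.
Unset Printing Implicit Defensive.

Import Order.TTheory GRing.Theory Num.Theory.

Local Open Scope ring_scope.

(* The first subtree of Node is the one followed when the queried variable is
   0 (false), the second one when it is 1 (true). *)
Inductive dtree (V T : Type) : Type :=
| Leaf of T
| Node of V & dtree V T & dtree V T.

Arguments Leaf {V T}.
Arguments Node {V T}.

Fixpoint dtree_eval (V : finType) (T : Type) (t : dtree V T)
    (x : {ffun V -> bool}) : T :=
  match t with
  | Leaf a => a
  | Node v t0 t1 => if x v then dtree_eval t1 x else dtree_eval t0 x
  end.

Fixpoint dtree_size (V T : Type) (t : dtree V T) : nat :=
  match t with
  | Leaf _ => 1%N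
  | Node _ t0 t1 => (dtree_size t0 + dtree_size t1)%N
  end.

Definition computes (V : finType) (T : Type) (t : dtree V T)
    (f : {ffun V -> bool} -> T) : Prop :=
  forall x, dtree_eval t x = f x.

Lemma dtree_exists (V : finType) (T : Type) (f : {ffun V -> bool} -> T) :
  exists t, computes t f.
Proof.
suff H (s : seq V) (g : {ffun V -> bool} -> T) :
    (forall x y : {ffun V -> bool}, {in s, x =1 y} -> g x = g y) ->
    exists t, computes t g.
  by apply: (H (enum V)) => x y xy; congr f; apply/ffunP => v;
    apply: xy; rewrite mem_enum.
elim: s g => [|v s IH] g gs.
  by exists (Leaf (g [ffun=> false])) => x; apply: gs.
pose upd b (x : {ffun V -> bool}) := [ffun w => if w == v then b else x w].
have updP b : exists t, computes t (g \o upd b).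
  apply: IH => x y xy; apply: gs => w; rewrite inE !ffunE.
  by case: eqP => //= _; apply: xy.
have [t0 t0P] := updP false; have [t1 t1P] := updP true.
exists (Node v t0 t1) => x /=; rewrite t0P t1P /=.
have updid : upd (x v) x = x.
  by apply/ffunP => w; rewrite ffunE; case: eqP => [->|].
by case E: (x v); rewrite -E updid.
Qed.

Definition has_dtree_of_size (V : finType) (T : Type)
    (f : {ffun V -> bool} -> T) : pred nat :=
  fun s => `[< exists2 t : dtree V T, computes t f & dtree_size t = s >].

Lemma has_dtree_of_some_size (V : finType) (T : Type)
    (f : {ffun V -> bool} -> T) : exists s, has_dtree_of_size f s.
Proof.
by have [t tf] := dtree_exists f; exists (dtree_size t); apply/asboolP; exists t.
Qed.

Definition DT (V : finType) (T : Type) (f : {ffun V -> bool} -> T) : nat :=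
  ex_minn (has_dtree_of_some_size f).

(* None stands for the symbol "*". *)
Definition restriction (n : nat) := {ffun 'I_n -> option bool}.

Definition stars (n : nat) (rho : restriction n) : {set 'I_n} :=
  [set i | rho i == None].

(* insub i is Some j, with val j = i, exactly when i is a star; the default
   value of odflt is therefore never used. *)
Definition restrict (n : nat) (T : Type) (f : {ffun 'I_n -> bool} -> T)
    (rho : restriction n) (y : {ffun {i | i \in stars rho} -> bool}) : T :=
  f [ffun i => if insub i is Some j then y j else odflt false (rho i)].

Arguments restrict {n T} f rho y.

(* The probability that the p-random restriction equals rho. *)
Definition random_restriction (R : realType) (n : nat) (p : R)
    (rho : restriction n) : R :=
  \prod_(i < n) (if rho i is Some _ then (1 - p) / 2 else p).

Lemma random_restriction_sum1 (R : realType) (n : nat) (p : R) :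
  \sum_(rho : restriction n) random_restriction p rho = 1.
Proof.
rewrite /random_restriction.
rewrite -(bigA_distr_bigA (fun=> fun o : option bool =>
  if o is Some _ then (1 - p) / 2 else p)) /=.
rewrite big1 // => i _; rewrite (bigD1 None) //= (bigD1 (Some true)) //=.
rewrite (bigD1 (Some false)) //= big1 => [|[[]|]//].
by rewrite addr0 -splitr addrCA subrr addr0.
Qed.

Definition expect_restriction (R : realType) (n : nat) (p : R)
    (X : restriction n -> R) : R :=
  \sum_(rho : restriction n) random_restriction p rho * X rho.

Definition log2 (R : realType) (x : R) : R := ln x / ln 2.

Definition parity (n k : nat) (x : {ffun 'I_n -> bool}) : bool :=
  \big[addb/false]_(i < n | (i < k)%N) x i.

Arguments parity n k x : clear implicits.

(* Main.v *)
Require Import Defs.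
From mathcomp Require Import all_boot all_order all_algebra.
From mathcomp Require Import boolp reals exp.
From mathcomp Require Import ring lra interval_inference convex hoelder.

(** Along a path of a decision tree that never repeats a variable, each queried
    variable is compatible with the path with probability [(1 + p) / 2], so the
    expected size [m(t)] of the restricted tree satisfies
    [m(Node v t0 t1) = (1 + p) / 2 * (m(t0) + m(t1))].  With
    [g = log2 (1 + p) <= 1], concavity of [x |-> x `^ g] gives
    [(1 + p) / 2 * (a `^ g + b `^ g) <= (a + b) `^ g], whence
    [m(t) <= (size t) `^ g] by induction.  For the parity of [k] variables, a
    restriction leaving [j] of them free yields a function that changes
    whenever one of these [j] variables is flipped; such a function needs [2 ^ j]
    leaves, and the expectation of [2 ^ j] is [(1 + p) ^ k = (2 ^ k) `^ g]. *)

Set Implicit Arguments.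
Unset Strict Implicit.
Unset Printing Implicit Defensive.

Import Order.TTheory GRing.Theory Num.Theory.

Local Open Scope ring_scope.

(** * Read-once trees, and upper and lower bounds on [DT] *)

Section DecisionTrees.
Variables (V : finType) (T : Type).
Implicit Types (t : dtree V T) (f : {ffun V -> bool} -> T).
Implicit Types (x y : {ffun V -> bool}) (D S U : {set V}).

Lemma DT_le f t : computes t f -> (DT f <= dtree_size t)%N.
Proof.
by move=> tf; rewrite /DT; case: ex_minnP => m _; apply; apply/asboolP; exists t.
Qed.

Lemma DT_witness f : exists2 t : dtree V T, computes t f & dtree_size t = DT f.
Proof. by rewrite /DT; case: ex_minnP => m /asboolP. Qed.

Definition upd (v : V) (b : bool) x : {ffun V -> bool} :=
  [ffun w => if w == v then b else x w].

Lemma upd_id v x : upd v (x v) x = x.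
Proof. by apply/ffunP => w; rewrite ffunE; case: eqP => [->|]. Qed.

Fixpoint read_once (D : {set V}) (t : dtree V T) : bool :=
  if t is Node v t0 t1 then
    [&& v \notin D, read_once (v |: D) t0 & read_once (v |: D) t1]
  else true.

(** The set [D] collects the variables queried above [t], and [x] records their answers. A repeated
    query thus has a known answer, and only the branch it selects is kept. *)
Lemma read_once_prune t D x :
  exists2 t' : dtree V T, read_once D t' & (dtree_size t' <= dtree_size t)%N /\
    forall y, {in D, y =1 x} -> dtree_eval t' y = dtree_eval t y.
Proof.
elim: t D x => [a|v t0 IH0 t1 IH1] D x; first by exists (Leaf a).
have [vD|vD] := boolP (v \in D).
  have [t0' r0 [s0 e0]] := IH0 D x; have [t1' r1 [s1 e1]] := IH1 D x.
  exists (if x v then t1' else t0'); first by case: (x v).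
  split; first by case: (x v) => /=; [exact: leq_trans (leq_addl _ _)|
                                      exact: leq_trans (leq_addr _ _)].
  by move=> y yx; rewrite /= yx //; case: (x v); [exact: e1|exact: e0].
have [t0' r0 [s0 e0]] := IH0 (v |: D) (upd v false x).
have [t1' r1 [s1 e1]] := IH1 (v |: D) (upd v true x).
exists (Node v t0' t1'); first by rewrite /= vD r0 r1.
split=> [|y yx]; first exact: leq_add.
have yE : {in v |: D, y =1 upd v (y v) x}.
  move=> w; rewrite !inE ffunE; case: eqP => [->//|_] /= wD; exact: yx.
by move: yE => /=; case: (y v) => yE; [exact: e1|exact: e0].
Qed.

Lemma DT_read_once_witness f :
  exists2 t : dtree V T, computes t f & read_once set0 t /\ dtree_size t = DT f.
Proof.
have [t tf st] := DT_witness f.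
have [t' rt' [st' et']] := read_once_prune t set0 [ffun=> false].
have t'f : computes t' f by move=> x; rewrite et' // => v; rewrite inE.
exists t' => //; split => //; apply/eqP.
by rewrite eqn_leq -{1}st st' DT_le.
Qed.

Lemma DT_junta (s : seq V) f :
  (forall x y, {in s, x =1 y} -> f x = f y) -> (DT f <= 2 ^ size s)%N.
Proof.
elim: s f => [|v s IH] f fs.
  by apply: (@DT_le f (Leaf (f [ffun=> false]))) => x; apply: fs.
have fupd b : (DT (f \o upd v b) <= 2 ^ size s)%N.
  apply: IH => x y xy; apply: fs => w; rewrite inE !ffunE.
  by case: eqP => //= _; apply: xy.
have [t0 e0 s0] := DT_witness (f \o upd v false).
have [t1 e1 s1] := DT_witness (f \o upd v true).
apply: (@leq_trans (dtree_size (Node v t0 t1))).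
  apply: DT_le => x /=; rewrite e0 e1 /= -[in RHS](upd_id v x).
  by case: (x v).
by rewrite /= expnS mul2n -addnn s0 s1 leq_add.
Qed.

(** Querying a variable of [U] removes one free coordinate from both branches, and a leaf can be
    reached only once none is left: the tree branches fully on [U]. *)
Lemma DT_sensitive U f :
  (forall x v, v \in U -> f (upd v (~~ x v) x) <> f x) -> (2 ^ #|U| <= DT f)%N.
Proof.
move=> fU; have [t tf <-] := DT_witness f.
(* Generalised to trees computing [f] on the subcube through [z] whose free
   coordinates are [S]. *)
suff sub S (z : {ffun V -> bool}) : S \subset U ->
    (forall x, {in ~: S, x =1 z} -> dtree_eval t x = f x) ->
    (2 ^ #|S| <= dtree_size t)%N.
  by apply: (sub U [ffun=> false]) => // x _; apply: tf.
elim: t S z {tf} => [a|v t0 IH0 t1 IH1] S z SU tf.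
  (* If [S] contained some [v], flipping [v] in [z] would stay in the subcube and change [f], but
     not the value of the leaf. *)
  case: (set_0Vmem S) => [->|[v vS]]; first by rewrite cards0.
  have /= ez := tf z (fun=> fun=> erefl).
  case: (fU z v (subsetP SU _ vS)); rewrite -ez; symmetry; apply: tf => w.
  by rewrite inE ffunE; case: eqP => // ->; rewrite vS.
have [vS|vS] := boolP (v \in S); last first.
  (* The query is answered by [z] on the whole subcube, so a single branch already computes [f]
     there. *)
  have tz x : {in ~: S, x =1 z} ->
      (if z v then dtree_eval t1 x else dtree_eval t0 x) = f x.
    by move=> xz; rewrite -(tf _ xz) /= xz // inE.
  case E: (z v) tz => tz; rewrite /=.
    exact: leq_trans (IH1 _ _ SU tz) (leq_addl _ _).
  exact: leq_trans (IH0 _ _ SU tz) (leq_addr _ _).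
have S1U : S :\ v \subset U by apply: subset_trans SU; apply: subD1set.
have branch b x : {in ~: (S :\ v), x =1 upd v b z} ->
    (if b then dtree_eval t1 x else dtree_eval t0 x) = f x.
  move=> xz; have xv : x v = b by rewrite xz ?ffunE ?eqxx // !inE eqxx.
  rewrite -tf /= ?xv // => w; rewrite inE => wS; rewrite xz ?ffunE.
    by case: eqP wS => // ->; rewrite vS.
  by rewrite !inE (negPf wS) andbF.
rewrite (cardsD1 v S) vS add1n expnS mul2n -addnn /=; apply: leq_add.
  exact: IH0 S1U (branch false).
exact: IH1 S1U (branch true).
Qed.

End DecisionTrees.

(** * Restricting a decision tree *)

Section RestrictedTrees.
Variables (n : nat) (T : Type).

Fixpoint restrict_dtree (rho : restriction n) (t : dtree 'I_n T) :
    dtree {i | i \in stars rho} T :=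
  match t with
  | Leaf a => Leaf a
  | Node v t0 t1 =>
      if insub v is Some j then
        Node j (restrict_dtree rho t0) (restrict_dtree rho t1)
      else if odflt false (rho v) then restrict_dtree rho t1
      else restrict_dtree rho t0
  end.

Lemma restrict_dtree_computes rho t f :
  computes t f -> computes (restrict_dtree rho t) (restrict f rho).
Proof.
move=> tf y; rewrite /restrict -tf; elim: t {tf} => //= v t0 IH0 t1 IH1.
rewrite ffunE; case: insub => [j|] /=; first by rewrite IH0 IH1.
by case: (odflt false (rho v)).
Qed.

(** A star keeps both subtrees, a fixed value only one. Writing this with indicators makes the size
    linear in the subtree sizes, ready for taking expectations. *)
Lemma dtree_size_restrict_node rho v t0 t1 :
  dtree_size (restrict_dtree rho (Node v t0 t1)) =
    ((rho v != Some true) * dtree_size (restrict_dtree rho t0) +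
     (rho v != Some false) * dtree_size (restrict_dtree rho t1))%N.
Proof.
rewrite /=; case: insubP => [j|]; rewrite inE; first by move/eqP => ->; rewrite !mul1n.
by case: (rho v) => [[]|] //= _; rewrite ?mul1n ?mul0n ?addn0.
Qed.

End RestrictedTrees.

(** * Expected size of a restricted tree, and the upper bound *)

Section Expectation.
Variables (R : realType) (p : R).

Definition star_prob (o : option bool) : R :=
  if o is Some _ then (1 - p) / 2 else p.

Lemma sum_option_bool (F : option bool -> R) :
  \sum_o F o = F None + (F (Some true) + F (Some false)).
Proof.
rewrite (bigD1 None) //= (bigD1 (Some true)) //= (bigD1 (Some false)) //=.
by rewrite big1 ?addr0 // => -[[]|].
Qed.

(** The quantity [m(t)] of the overview; [expect_size_restrict] identifies it with the expected size
    for read-once trees. *)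
Fixpoint mean_size (V T : Type) (t : dtree V T) : R :=
  if t is Node _ t0 t1 then (1 + p) / 2 * (mean_size t0 + mean_size t1) else 1.

(* The weights [G i], for [i] in [D], record the conditioning on the queries
   made above [t]. *)
Lemma weighted_sum_size_restrict n T (t : dtree 'I_n T) (D : {set 'I_n})
    (G : 'I_n -> option bool -> R) :
  read_once D t -> (forall i, i \notin D -> G i =1 star_prob) ->
  \sum_(rho : restriction n)
      (\prod_i G i (rho i)) * (dtree_size (restrict_dtree rho t))%:R =
    (\prod_i \sum_o G i o) * mean_size t.
Proof.
elim: t D G => [a|v t0 IH0 t1 IH1] D G /=.
  move=> _ _; rewrite mulr1 bigA_distr_bigA /=.
  by apply: eq_bigr => rho _; rewrite mulr1.
case/and3P => vD r0 r1 GD.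
(* The weights [H b] absorb the indicator that the branch [b] of [v] survives. *)
pose H b i o := if i == v then G i o * (o != Some (~~ b))%:R else G i o.
have HD b i : i \notin v |: D -> H b i =1 star_prob.
  by rewrite !inE negb_or => /andP[iv iD] o; rewrite /H (negPf iv) GD.
have prodH b (rho : restriction n) : \prod_i H b i (rho i) =
    \prod_i G i (rho i) * (rho v != Some (~~ b))%:R.
  rewrite (bigD1 v) //= [in RHS](bigD1 v) //= {1}/H eqxx -!mulrA; congr (_ * _).
  rewrite mulrC; congr (_ * _); apply: eq_bigr => i iv.
  by rewrite /H (negPf iv).
(* Since [v] is not in [D], its total mass drops from 1 to [p + (1 - p) / 2]. *)
have sumH b : \prod_i \sum_o H b i o = (1 + p) / 2 * \prod_i \sum_o G i o.
  rewrite (bigD1 v) //= [in RHS](bigD1 v) //= mulrA; congr (_ * _).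
    rewrite !sum_option_bool /H eqxx !GD //= /star_prob.
    by case: b => /=; field.
  by apply: eq_bigr => i iv; rewrite /H (negPf iv).
transitivity (\sum_(rho : restriction n)
    ((\prod_i H false i (rho i)) * (dtree_size (restrict_dtree rho t0))%:R +
     (\prod_i H true i (rho i)) * (dtree_size (restrict_dtree rho t1))%:R)).
  apply: eq_bigr => rho _; rewrite -/(restrict_dtree rho (Node v t0 t1)).
  by rewrite dtree_size_restrict_node natrD !natrM mulrDr !mulrA !prodH.
rewrite big_split /= (IH0 _ _ r0 (HD false)) (IH1 _ _ r1 (HD true)) !sumH.
by rewrite -mulrDr -mulrA mulrCA.
Qed.

Lemma expect_size_restrict n T (t : dtree 'I_n T) : read_once set0 t ->
  expect_restriction p
      (fun rho : restriction n => (dtree_size (restrict_dtree rho t))%:R) =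
    mean_size t.
Proof.
move=> rt; rewrite -[RHS]mul1r.
(* The factor 1 is the product of the total masses of the unconditioned weights. *)
rewrite -[1 in RHS](@big1 _ _ *%R _ (index_enum 'I_n) xpredT
                      (fun=> \sum_o star_prob o)).
  exact: weighted_sum_size_restrict rt _.
by move=> i _; rewrite sum_option_bool /star_prob; field.
Qed.

Lemma log2_ge0 (hp : 0 <= p <= 1) : 0 <= log2 (1 + p).
Proof. by rewrite divr_ge0 //; apply: ln_ge0; lra. Qed.

Lemma log2_le1 (hp : 0 <= p <= 1) : log2 (1 + p) <= 1.
Proof.
have l2 : 0 < ln (2 : R) by apply: ln_gt0; lra.
by rewrite ler_pdivrMr // mul1r ler_ln ?posrE; lra.
Qed.

Lemma powR_log2 (hp : 0 <= p <= 1) : 2 `^ log2 (1 + p) = 1 + p.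
Proof.
have l2 : 0 < ln (2 : R) by apply: ln_gt0; lra.
by rewrite /powR pnatr_eq0 /= /log2 divfK ?gt_eqF // lnK // posrE; lra.
Qed.

(** For positive [g] this is the convexity of the power [g^-1] at the points [a]^ g[and]b [^ g]; the
    case [g = 0] is treated apart. *)
Lemma powR_midpoint_concave (a b g : R) : 0 <= a -> 0 <= b -> 0 <= g <= 1 ->
  (a `^ g + b `^ g) / 2 <= ((a + b) / 2) `^ g.
Proof.
move=> a0 b0 /andP[]; rewrite le_eqVlt => /predU1P[<- _|g0 g1].
  by rewrite !powRr0; lra.
have gV : 1 <= g^-1 by rewrite invf_ge1.
have h0 : 0 <= 2^-1 :> R by lra.
have h1 : 2^-1 <= 1 :> R by lra.
have gK c : 0 <= c -> (c `^ g) `^ g^-1 = c.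
  by move=> c0; rewrite -powRrM divff ?gt_eqF // powRr1.
have convex : ((a `^ g + b `^ g) / 2) `^ g^-1 <= (a + b) / 2.
  have := convex_powR gV (Itv01 h0 h1) (x := a `^ g) (y := b `^ g).
  rewrite !classical_sets.in_setE /= !in_itv /= !powR_ge0 => /(_ isT isT).
  have convE (x y : R) : conv (Itv01 h0 h1) (x : R^o) (y : R^o) = (x + y) / 2.
    by rewrite convRE /= /unstable.onem; field.
  by rewrite !gK // convE [X in X `^ _ <= _ -> _]convE.
have m0 : 0 <= (a `^ g + b `^ g) / 2 by rewrite divr_ge0 // addr_ge0 ?powR_ge0.
rewrite -[leLHS]powRr1 // -[X in _ `^ X](mulVf (lt0r_neq0 g0)) powRrM.
apply: ge0_ler_powR => //; rewrite ?nnegrE ?powR_ge0 ?(ltW g0) //.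
by rewrite divr_ge0 // addr_ge0.
Qed.

Lemma mean_size_le (V T : Type) (t : dtree V T) (hp : 0 <= p <= 1) :
  mean_size t <= (dtree_size t)%:R `^ log2 (1 + p).
Proof.
elim: t => [a|v t0 IH0 t1 IH1] /=; first by rewrite powR1.
set g := log2 (1 + p) in IH0 IH1 *.
have p1 : 0 <= 1 + p by lra.
have g01 : 0 <= g <= 1 by rewrite /g log2_ge0 // log2_le1.
rewrite natrD -mulrA.
set a : R := (dtree_size t0)%:R; set b : R := (dtree_size t1)%:R.
have -> : a + b = 2 * ((a + b) / 2) by field.
rewrite powRM ?divr_ge0 ?addr_ge0 // /g (powR_log2 hp) ler_wpM2l //.
apply: le_trans (powR_midpoint_concave _ _ g01) => //.
by rewrite mulrC ler_wpM2r ?invr_ge0 // lerD.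
Qed.

Lemma random_restriction_ge0 n (rho : restriction n) (hp : 0 <= p <= 1) :
  0 <= random_restriction p rho.
Proof. by apply: prodr_ge0 => i _; case: (rho i) => [_|]; lra. Qed.

Lemma expect_restriction_le n (X Y : restriction n -> R) (hp : 0 <= p <= 1) :
  (forall rho, X rho <= Y rho) -> expect_restriction p X <= expect_restriction p Y.
Proof.
by move=> XY; apply: ler_sum => rho _; rewrite ler_wpM2l ?random_restriction_ge0.
Qed.

Lemma expect_DT_le n T (f : {ffun 'I_n -> bool} -> T) (hp : 0 <= p <= 1) :
  expect_restriction p (fun rho : restriction n => (DT (restrict f rho))%:R)
    <= (DT f)%:R `^ log2 (1 + p).
Proof.
have [t tf [rt <-]] := DT_read_once_witness f.
apply: le_trans (mean_size_le t hp); rewrite -expect_size_restrict //.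
apply: expect_restriction_le => // rho; rewrite ler_nat.
exact/DT_le/restrict_dtree_computes.
Qed.

End Expectation.

(** * Equality for parity functions *)

Section Parity.
Variables (n k : nat).
Hypothesis kn : (k <= n)%N.

Lemma DT_parity_le : (DT (parity n k) <= 2 ^ k)%N.
Proof.
pose s := [seq widen_ord kn i | i <- enum 'I_k].
rewrite (_ : (2 ^ k)%N = 2 ^ size s)%N; last by rewrite size_map size_enum_ord.
apply: DT_junta => x y xy; apply: eq_bigr => i ik; apply: xy.
apply/mapP; exists (Ordinal ik); first by rewrite mem_enum.
exact: val_inj.
Qed.

Lemma DT_restrict_parity_ge (rho : restriction n) :
  (2 ^ #|[set i : 'I_n | (i < k)%N & rho i == None]|
     <= DT (restrict (parity n k) rho))%N.
Proof.
pose U := [set j : {i | i \in stars rho} | (val j < k)%N].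
have -> : [set i : 'I_n | (i < k)%N & rho i == None] = val @: U.
  apply/setP => i; rewrite inE; apply/andP/imsetP => [[ik ri]|[j]].
    have ir : i \in stars rho by rewrite inE.
    by exists (Sub i ir); rewrite ?inE ?SubK.
  by rewrite inE => jk ->; split => //; have := valP j; rewrite inE.
rewrite card_imset; last exact: val_inj.
apply: DT_sensitive => y j; rewrite inE => jk.
rewrite /restrict /parity (bigD1 (val j)) //= [X in _ <> X](bigD1 (val j)) //=.
rewrite !ffunE valK ffunE eqxx.
(* The flip at [j] leaves all other summands unchanged, so the parity is negated. *)
under eq_bigr => i /andP[_ ij].
  rewrite ffunE.
  have -> : (if insub i is Some j' then upd j (~~ y j) y j'
             else odflt false (rho i)) =
            [ffun i => if insub i is Some j' then y j'
                       else odflt false (rho i)] i.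
    rewrite ffunE; case: insubP => // j' _ ij'.
    by rewrite ffunE ifN //; apply: contra ij => /eqP <-; rewrite ij'.
  over.
by rewrite addNb; case: (_ (+) _).
Qed.

(** The power of 2 is a product over coordinates, so by independence each [i < k] contributes
    [2 * p + (1 - p)] and every other one contributes 1. *)
Lemma expect_pow_stars (R : realType) (p : R) :
  expect_restriction p (fun rho : restriction n =>
      (2 ^ #|[set i : 'I_n | (i < k)%N & rho i == None]|)%:R) = (1 + p) ^+ k.
Proof.
pose w (i : 'I_n) o : R := star_prob p o * (if (i < k)%N && (o == None) then 2 else 1).
transitivity (\prod_(i < n) \sum_o w i o); last first.
  transitivity (\prod_(i < n | (i < k)%N) (1 + p)); last first.
    by rewrite -(big_ord_widen _ (fun=> 1 + p)) // prodr_const card_ord.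
  rewrite [RHS]big_mkcond /=; apply: eq_bigr => i _.
  by rewrite sum_option_bool /w /star_prob; case: (i < k)%N => /=; field.
rewrite bigA_distr_bigA; apply: eq_bigr => rho _ /=.
rewrite /random_restriction big_split /=; congr (_ * _).
rewrite -big_mkcond /= prodr_const natrX; congr (_ ^+ _).
by apply: eq_card => i; rewrite !inE.
Qed.

End Parity.

Theorem theorem1p2 (R : realType) (n : nat) (hn : (1 <= n)%N)
    (p : R) (hp : 0 <= p <= 1) :
  (forall (T : Type) (f : {ffun 'I_n -> bool} -> T),
     expect_restriction p (fun rho : restriction n => (DT (restrict f rho))%:R)
       <= (DT f)%:R `^ log2 (1 + p)) /\
  (forall k : nat, (1 <= k <= n)%N ->
     expect_restriction p
         (fun rho : restriction n => (DT (restrict (parity n k) rho))%:R)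
       = (DT (parity n k))%:R `^ log2 (1 + p)).
Proof.
split=> [T f|k /andP[_ kn]]; first exact: expect_DT_le.
apply/eqP; rewrite eq_le expect_DT_le //=.
apply: (@le_trans _ _ ((1 + p) ^+ k)).
  have -> : (1 + p) ^+ k = (2 ^+ k) `^ log2 (1 + p).
    by rewrite -{1}(powR_log2 hp) -powR_mulrn ?powR_ge0 // powRAC powR_mulrn.
  apply: ge0_ler_powR; rewrite ?nnegrE ?log2_ge0 ?exprn_ge0 //.
  by rewrite -natrX ler_nat DT_parity_le.
rewrite -(expect_pow_stars kn); apply: expect_restriction_le => // rho.
by rewrite ler_nat DT_restrict_parity_ge.
Qed.
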